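(* Suppose $(X,\mathcal{A},\mu)$ is a complete measure space with $\mu(X)<\infty$. Then a function $f : X \rightarrow \mathbb{R}$ is integrable in the sense of charges (defined via determining sequences of simple functions) if and only if it is Lebesgue integrable. Moreover, the two types of integral are equal.
   Context: For a finite measure space $(X,\mathcal{A},\mu)$ (regarded as a bounded finitely additive charge space): the outer charge is $\mu^*(A):=\inf\{\mu(B): B\in\mathcal{A}, A\subseteq B\}$ for $A\subseteq X$. A sequence $f_n:X\to\mathbb{R}$ converges hazily to $f$ if for every $\epsilon>0$, $\mu^*(\{x:|f_n(x)-f(x)|>\epsilon\})\to 0$. A simple function is $\sum_{k=1}^K c_kI_{A_k}$ with $c_k\in\mathbb{R}$ and $\{A_1,\dots,A_K\}\subset\mathcal{A}$ a finite partition of $X$; its integral is $\sum_k c_k\mu(A_k)$. A function $f:X\to\mathbb{R}$ is integrable in the sense of charges if there is a sequence of simple functions $\{f_n\}$ (a determining sequence) with $f_n\to f$ hazily and $\int|f_n-f_m|d\mu\to0$ as $n,m\to\infty$; the integral is then $\int f d\mu:=\lim_n\int f_n d\mu$, which does not depend on the determining sequence. *)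

(* Defs.v *)
From HB Require Import structures.
From mathcomp Require Import all_boot all_order all_algebra.
From mathcomp Require Import all_classical all_reals all_analysis.

Set Implicit Arguments.
Unset Strict Implicit.
Unset Printing Implicit Defensive.
Import Order.TTheory GRing.Theory Num.Theory.
Import numFieldNormedType.Exports.
Import HBSimple.

Local Open Scope classical_set_scope.
Local Open Scope ring_scope.

(* Simple functions are the measurable functions with finite range,
   {sfun T >-> R}, and their integral is sintegral, the sum of
   x * mu (g @^-1` [set x]) over the values x.  The next three lemmas identify
   these with the combinations of indicators of a finite measurable partition
   (A k), whose integral is \sum_k c k * mu (A k). *)

Lemma sfun_partition d (T : measurableType d) (R : realType)
    (g : {sfun T >-> R}) :
  exists (K : nat) (c : 'I_K -> R) (A : 'I_K -> set T),
    [/\ forall k, measurable (A k), trivIset [set: 'I_K] A,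
        \bigcup_k A k = [set: T]
      & forall x, g x = \sum_(k < K) c k * \1_(A k) x].
Proof.
have /finite_seqP[s0 gs0] : finite_set (range g) by exact: fimfunP.
pose s := undup s0.
have gs x : g x \in s.
  have : range g (g x) by exists x.
  by rewrite gs0 /= mem_undup.
exists (size s), (fun k => s`_k), (fun k => g @^-1` [set s`_k]); split.
- by move=> k; exact: measurable_funPTI.
- move=> i j _ _ [x [/= gi gj]]; apply/val_inj/eqP.
  by rewrite -(nth_uniq 0 (ltn_ord i) (ltn_ord j) (undup_uniq s0)) -/s -gi -gj.
- apply/seteqP; split=> // x _; have xs := gs x; move: (xs).
  by rewrite -index_mem => h; exists (Ordinal h) => //=; rewrite nth_index.
- move=> x; have := gs x; rewrite -index_mem => h.
  rewrite (bigD1 (Ordinal h))//= big1 ?addr0; last first.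
    move=> k kh; rewrite indicE memNset ?mulr0//= => gk; move/eqP: kh; apply.
    by apply/val_inj; rewrite /= gk index_uniq ?undup_uniq.
  by rewrite indicE mem_set/= nth_index ?mulr1.
Qed.

Lemma partition_sfun d (T : measurableType d) (R : realType) (K : nat)
    (c : 'I_K -> R) (A : 'I_K -> set T) :
  (forall k, measurable (A k)) ->
  exists g : {sfun T >-> R}, forall x, g x = \sum_(k < K) c k * \1_(A k) x.
Proof.
move=> mA; exists (\sum_(k < K) (cst_sfun (c k) * @indic_sfun _ _ R _ (mA k))) => x.
by rewrite sfun_sum; apply: eq_bigr => k _.
Qed.

Lemma sintegral_partition d (T : measurableType d) (R : realType)
    (mu : {measure set T -> \bar R}) (K : nat)
    (c : 'I_K -> R) (A : 'I_K -> set T) (g : T -> R) :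
  (forall k, measurable (A k)) -> trivIset [set: 'I_K] A ->
  \bigcup_k A k = [set: T] ->
  (forall x, g x = \sum_(k < K) c k * \1_(A k) x) ->
  sintegral mu g = (\sum_(k < K) (c k)%:E * mu (A k))%E.
Proof.
move=> mA tA cA gE.
have gA k x : A k x -> g x = c k.
  move=> Akx; rewrite gE (bigD1 k)//= indicE mem_set//= mulr1 big1 ?addr0//.
  move=> j jk; rewrite indicE memNset ?mulr0// => Ajx.
  by move/eqP: jk; apply; apply: tA => //; exists x.
pose s := undup [seq c k | k <- enum 'I_K].
have cs k : c k \in s by rewrite mem_undup map_f// mem_enum.
have preE r : g @^-1` [set r] = \big[setU/set0]_(k < K | c k == r) A k.
  rewrite -bigcup_pred; apply/seteqP; split=> x /=.
    move=> gx; have [k _ Akx] : (\bigcup_k A k) x by rewrite cA.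
    by exists k => //=; apply/eqP; rewrite -gx (gA k).
  by move=> [k /= /eqP <- /gA].
rewrite /sintegral (@fsbigE _ _ _ _ _ s) ?undup_uniq//; last first.
  move=> r _ rs; rewrite preE big_pred0 ?measure0 ?mule0// => k.
  by apply: contraNF rs => /eqP <-.
rewrite (eq_bigr (fun r => \sum_(k < K | c k == r) r%:E * mu (A k))%E).
  2: by move=> r _; rewrite preE measure_bigsetU_ord// ge0_sume_distrr.
rewrite (exchange_big_dep predT)//=; apply: eq_bigr => k _.
rewrite (eq_bigl (pred1 (c k))); last by move=> r; rewrite in_setT /= eq_sym.
by rewrite -big_filter filter_pred1_uniq ?undup_uniq// big_seq1.
Qed.

Definition outer_charge d (T : measurableType d) (R : realType)
    (mu : set T -> \bar R) (A : set T) : \bar R :=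
  ereal_inf [set mu B | B in [set B | measurable B /\ A `<=` B]].

Definition hazy_cvg d (T : measurableType d) (R : realType)
    (mu : set T -> \bar R) (f_ : nat -> T -> R) (f : T -> R) : Prop :=
  forall e : R, 0 < e ->
    outer_charge mu [set x | e < `|f_ n x - f x|] @[n --> \oo] --> 0%E.

Definition determining d (T : measurableType d) (R : realType)
    (mu : set T -> \bar R) (f_ : nat -> {sfun T >-> R}) (f : T -> R) : Prop :=
  hazy_cvg mu f_ f /\
  sintegral mu (fun x => `|f_ nm.1 x - f_ nm.2 x|) @[nm --> (\oo, \oo)] --> 0%E.

Definition charge_integrable d (T : measurableType d) (R : realType)
    (mu : set T -> \bar R) (f : T -> R) : Prop :=
  exists f_ : nat -> {sfun T >-> R}, determining mu f_ f.

(* The charge integral is the limit of the integrals of a determining sequence,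
   whichever determining sequence is used.  Independence of the sequence is
   part of what is asserted, so that the value I is unique, being the limit of
   a sequence in a Hausdorff space. *)
Definition is_charge_integral d (T : measurableType d) (R : realType)
    (mu : set T -> \bar R) (f : T -> R) (I : R) : Prop :=
  charge_integrable mu f /\
  forall f_ : nat -> {sfun T >-> R}, determining mu f_ f ->
    sintegral mu (f_ n) @[n --> \oo] --> I%:E.

(* Main.v *)
(* A hazily convergent sequence has, by Borel-Cantelli, a subsequence that
   converges almost everywhere, and completeness makes its limit f measurable.
   By Fatou's lemma along that subsequence, a determining sequence f_n satisfies
   \int |f_n - f| <= liminf_k \int |f_n - f_(phi k)|, which is small for n large
   by the Cauchy condition: so f_n -> f in L^1, whence f is integrable and the
   integrals converge.  Conversely, simple functions approximating an
   integrable f in L^1 are Cauchy, and converge hazily by Markov's inequality. *)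
Require Import Defs.
From mathcomp Require Import all_boot all_order all_algebra.
From mathcomp Require Import all_classical all_reals all_analysis.
From mathcomp Require Import measurable_realfun.
Set Implicit Arguments.
Unset Strict Implicit.
Unset Printing Implicit Defensive.
Import Order.TTheory GRing.Theory Num.Theory.
Import numFieldNormedType.Exports.
Import HBSimple.
Local Open Scope classical_set_scope.
Local Open Scope ring_scope.

Section charge_integral.
Context d (T : measurableType d) (R : realType).

(** * Simple functions and their Lebesgue integrals *)

(** Since [g] may change sign, both sides are computed on a finite measurable partition: each is the
    sum of [c k * mu (A k)], the Lebesgue side by linearity, as indicators are integrable for a
    finite [mu]. *)
Lemma sintegral_integral (mu : {finite_measure set T -> \bar R}) (g : T -> R) :
  measurable_fun [set: T] g -> finite_set (range g) ->
  sintegral mu g = (\int[mu]_x (g x)%:E)%E.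
Proof.
move=> mg fg.
have gP : g \in sfun by apply/andP; split; apply/mem_set.
have [K [c [A [mA tA cA gE]]]] := sfun_partition (sfun_Sub gP).
have {}gE x : g x = \sum_(k < K) c k * \1_(A k) x by exact: gE.
rewrite (sintegral_partition mu mA tA cA gE).
under [RHS]eq_integral do rewrite gE -sumEFin.
have ci k : mu.-integrable [set: T] (EFin \o (\1_(A k) : T -> R)).
  exact: integrable_indic.
rewrite integral_sum//=.
  apply: eq_bigr => k _; under eq_integral do rewrite EFinM.
  by rewrite (integralZl measurableT (ci k)) integral_indic ?setIT.
by move=> k; exact: (integrableZl _ _ (ci k)).
Qed.

Lemma sfun_integrable (mu : {finite_measure set T -> \bar R}) (g : {sfun T >-> R}) :
  mu.-integrable [set: T] (EFin \o g).
Proof.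
apply: measurable_bounded_integrable => //.
- by rewrite ltey_eq fin_num_measure.
- exact: simple_bounded.
Qed.

Lemma measurable_abse_EFinB (g h : T -> R) :
  measurable_fun [set: T] g -> measurable_fun [set: T] h ->
  measurable_fun [set: T] (fun x => `|(g x - h x)%:E|%E).
Proof.
by move=> mg mh; apply: measurableT_comp => //; apply/measurable_EFinP/measurable_funB.
Qed.

Lemma sintegral_norm_sfunB (mu : {finite_measure set T -> \bar R})
    (g h : {sfun T >-> R}) :
  sintegral mu (fun x => `|g x - h x|) = (\int[mu]_x `|(g x - h x)%:E|)%E.
Proof.
rewrite sintegral_integral//.
  by apply: measurableT_comp => //; exact: measurable_funB.
apply: (@sub_finite_set _ _ (Num.norm @` range (g - h))).
  by move=> _ [x _ <-]; exists (g x - h x) => //; exists x.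
by apply: finite_image; exact: fimfunP.
Qed.

(** * Outer charge, hazy convergence and almost everywhere convergence *)

Lemma cvge_lt I (F : set_system I) {FF : Filter F} (u : I -> \bar R) (l e : \bar R) :
  u i @[i --> F] --> l -> (l < e)%E -> \forall i \near F, (u i < e)%E.
Proof.
move=> ul le; apply: (ul [set y | (y < e)%E]).
by apply: open_nbhs_nbhs; split => //; exact: open_ereal_lt_ereal.
Qed.

Lemma outer_charge_lt (mu : {measure set T -> \bar R}) (A : set T) (e : \bar R) :
  (outer_charge mu A < e)%E -> exists B, [/\ measurable B, A `<=` B & (mu B < e)%E].
Proof.
by move=> /ereal_inf_lt[_ [B [mB AB] <-] Be]; exists B.
Qed.

Lemma outer_charge_ge0 (mu : {measure set T -> \bar R}) (A : set T) :
  (0 <= outer_charge mu A)%E.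
Proof. by apply: le_ereal_inf_tmp => _ [B _ <-]; exact: measure_ge0. Qed.

Lemma hazy_cvg_ae (mu : {measure set T -> \bar R}) (f_ : nat -> T -> R) (f : T -> R) :
  hazy_cvg mu f_ f -> exists phi : nat -> nat, (forall k, (k <= phi k)%N) /\
    {ae mu, forall x, f_ (phi k) x @[k --> \oo] --> f x}.
Proof.
move=> ff.
(* The set where [f_ n] is [2^-1 ^+ k]-far from [f] may fail to be measurable, so a measurable cover
   [nB.2] is chosen with it. Its measure bound is the term of a series with sum at most 1, and
   [k <= nB.1] will make the indices tend to infinity. *)
have H k : exists nB : nat * set T, [/\ (k <= nB.1)%N, measurable nB.2,
    [set x | 2^-1 ^+ k < `|f_ nB.1 x - f x|] `<=` nB.2
    & (mu nB.2 < (1 / (2 ^ k.+1)%:R)%:E)%E].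
  have k0 : 0 < 2^-1 ^+ k :> R by rewrite exprn_gt0.
  have l0 : (0 < (1 / (2 ^ k.+1)%:R : R)%:E)%E by rewrite lte_fin divr_gt0// ltr0n expn_gt0.
  have [n _ /(_ n (leqnn _))[kn]] : \forall n \near \oo, (k <= n)%N /\
      (outer_charge mu [set x | (2^-1 ^+ k < `|f_ n x - f x|)%R] <
       (1 / (2 ^ k.+1)%:R)%:E)%E.
    by apply: filterI; [exact: nbhs_infty_ge|exact: cvge_lt (ff _ k0) l0].
  by move=> /outer_charge_lt[B [mB AB Be]]; exists (n, B).
have {H}[nB nBP] := choice H.
exists (fun k => (nB k).1); split=> [k|]; first by case: (nBP k).
pose B k := (nB k).2.
(* The null set consists of the points in infinitely many [B k]. Any other point leaves all [B k]
   from some rank on, and there the error is at most [2^-1 ^+ k]. *)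
exists (lim_sup_set B); split.
- apply: bigcap_measurable => // n _; apply: bigcup_measurable => j _.
  by case: (nBP j).
- apply: lim_sup_set_cvg0 => [k|]; first by case: (nBP k).
  apply: (@le_lt_trans _ _ 1%:E); last exact: ltry.
  apply: le_trans (@epsilon_trick0 R 1 xpredT ler01).
  by apply: lee_nneseries => // k _; have [_ _ _ /ltW] := nBP k.
- move=> x /=; apply: contra_notP => xB.
  have [n nx] : exists n, forall j, (n <= j)%N -> ~ B j x.
    apply: contrapT => /forallNP h; apply: xB => n _.
    have /existsNP[j /not_implyP[nj /contrapT Bj]] := h n.
    by exists j.
  apply/cvgrPdist_le => e e0.
  have : 2^-1 ^+ k @[k --> \oo] --> (0 : R).
    by apply: cvg_expr; rewrite ger0_norm// invf_lt1// ltr1n.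
  move=> /cvgr0Pnorm_le /(_ e e0) he.
  near=> k; have [_ _ sB _] := nBP k.
  rewrite distrC; apply: (@le_trans _ _ (2^-1 ^+ k)).
    rewrite leNgt; apply/negP => kx; apply: (nx k); last exact: sB.
    by near: k; exact: nbhs_infty_ge.
  apply: le_trans (ler_norm _) _.
  by near: k.
Unshelve. all: by end_near. Qed.


(** The upper limit [h] of the sequence is measurable and defined everywhere, with extended values;
    [f] agrees with it almost everywhere and inherits measurability by completeness. *)
Lemma ae_cvg_measurable_fun (mu : {measure set T -> \bar R})
    (f_ : nat -> T -> R) (f : T -> R) : measure_is_complete mu ->
  (forall n, measurable_fun [set: T] (f_ n)) ->
  {ae mu, forall x, f_ n x @[n --> \oo] --> f x} -> measurable_fun [set: T] f.
Proof.
move=> cmu mf_ f_f; apply/measurable_EFinP.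
pose h x := limn_esup (fun n => (f_ n x)%:E).
apply: (@ae_measurable_fun _ _ _ _ cmu _ h).
  apply: filterS f_f => x f_fx _; rewrite /h/=.
  suff /cvg_limn_einf_sup[_ ->] : (f_ n x)%:E @[n --> \oo] --> (f x)%:E by [].
  by apply: cvg_EFin => //; exact: nearW.
by apply: measurable_fun_limn_esup => n; exact/measurable_EFinP.
Qed.

(** * Determining sequences converge in L^1 *)

Lemma limn_einf_le (u : (\bar R)^nat) (l : \bar R) :
  (\forall n \near \oo, (u n <= l)%E) -> (limn_einf u <= l)%E.
Proof.
move=> ul; rewrite limn_einf_lim; apply: lime_le; first exact: is_cvg_einfs.
apply: filterS ul => n; apply: le_trans; apply: ereal_inf_lbound.
by exists n => /=.
Qed.

Lemma cvge0_le (u : (\bar R)^nat) : (forall n, (0 <= u n)%E) ->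
  (forall e : R, 0 < e -> \forall n \near \oo, (u n <= e%:E)%E) ->
  u n @[n --> \oo] --> 0%E.
Proof.
move=> u0 ul; apply/fine_cvgP; split.
  (* The bound 1 already makes the terms finite eventually. *)
  apply: filterS (ul 1 ltr01) => n un; rewrite ge0_fin_numE//.
  exact: le_lt_trans un (ltry _).
apply/cvgr0Pnorm_le => e /ul; apply: filterS => n un.
rewrite ger0_norm ?fine_ge0// -lee_fin fineK// ge0_fin_numE//.
exact: le_lt_trans un (ltry _).
Qed.

Lemma determining_cvg_L1 (mu : {finite_measure set T -> \bar R})
    (f_ : nat -> {sfun T >-> R}) (f : T -> R) :
  measure_is_complete mu -> determining mu f_ f ->
  measurable_fun [set: T] f /\
  (\int[mu]_x `|(f_ n x - f x)%:E|)%E @[n --> \oo] --> 0%E.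
Proof.
move=> cmu [/hazy_cvg_ae [phi [phi_ge phi_cvg]]] f_C.
have mf : measurable_fun [set: T] f.
  apply: (ae_cvg_measurable_fun cmu _ phi_cvg) => n.
  exact: measurable_funPT.
split=> //; apply: cvge0_le => [n|e e0]; first exact: integral_ge0.
have [[A B] /= [[a _ aA] [b _ bB]] AB] :
    \forall nm \near (\oo, \oo),
      (sintegral mu (fun x => `|f_ nm.1 x - f_ nm.2 x|)%R <= e%:E)%E.
  have e0' : (0 < e%:E)%E by rewrite lte_fin.
  by apply: filterS (cvge_lt f_C e0') => nm /ltW.
exists a => // n an.
(* Almost everywhere, [|f_ n - f|] is the lower limit of [|f_ n - f_ (phi k)|], to which Fatou
   applies; the Cauchy bound covers every [k >= b] because [phi k >= k]. *)
rewrite (@ae_eq_integral _ _ _ mu _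
  (fun x => limn_einf (fun k => `|(f_ n x - f_ (phi k) x)%:E|%E)))//.
- apply: le_trans (fatou _ _ _ _) _ => //.
  + by move=> k; apply: measurable_abse_EFinB; exact: measurable_funPT.
  + apply: limn_einf_le; exists b => // k bk /=.
    rewrite -sintegral_norm_sfunB; apply: (AB (n, phi k)); split; first exact: aA.
    by apply: bB; exact: leq_trans bk (phi_ge k).
- by apply: measurable_abse_EFinB => //; exact: measurable_funPT.
- apply: measurableT_comp => //; apply: measurable_fun_limn_esup => k.
  by apply: measurableT_comp => //; apply: measurable_abse_EFinB; exact: measurable_funPT.
- apply: filterS phi_cvg => x cx _.
  suff /cvg_limn_einf_sup[-> _] :
    `|(f_ n x - f_ (phi k) x)%:E|%E @[k --> \oo] --> `|(f_ n x - f x)%:E|%E by [].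
  apply: cvg_EFin; first by apply: nearW.
  by apply: cvg_norm; apply: cvgB => //; exact: cvg_cst.
Qed.

(** A single [n] at L^1 distance less than 1 from [f] suffices: [f] is the difference of the
    integrable functions [f_ n] and [f_ n - f]. *)
Lemma cvg_L1_integrable (mu : {finite_measure set T -> \bar R})
    (f_ : nat -> {sfun T >-> R}) (f : T -> R) :
  measurable_fun [set: T] f ->
  (\int[mu]_x `|(f_ n x - f x)%:E|)%E @[n --> \oo] --> 0%E ->
  mu.-integrable [set: T] (EFin \o f).
Proof.
move=> mf f_f.
have [n _ /(_ n (leqnn n)) nfin] :
    \forall n \near \oo, (\int[mu]_x `|(f_ n x - f x)%:E| < 1)%E.
  exact: cvge_lt f_f lte01.
have ifn : mu.-integrable [set: T] (EFin \o (f_ n \- f)).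
  apply/integrableP; split; last exact: lt_trans nfin (ltry _).
  by apply/measurable_EFinP/measurable_funB.
rewrite (_ : EFin \o f = ((EFin \o f_ n) \- (EFin \o (f_ n \- f)%R))%E); last first.
  by apply/funext => x /=; rewrite -EFinB subKr.
by apply: integrableB => //; exact: sfun_integrable.
Qed.

Lemma cvg_L1_sintegral (mu : {finite_measure set T -> \bar R})
    (f_ : nat -> {sfun T >-> R}) (f : T -> R) :
  mu.-integrable [set: T] (EFin \o f) ->
  (\int[mu]_x `|(f_ n x - f x)%:E|)%E @[n --> \oo] --> 0%E ->
  sintegral mu (f_ n) @[n --> \oo] --> (\int[mu]_x (f x)%:E)%E.
Proof.
move=> intf f_f; have If := integrable_fin_num measurableT intf.
apply/sube_cvg0 => //.
have ifn n : mu.-integrable [set: T] (EFin \o f_ n) by exact: sfun_integrable.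
apply/cvg_abse0P; apply: (squeeze_cvge _ (cvg_cst _) f_f).
apply: nearW => n; rewrite abse_ge0/= sintegral_integral//.
rewrite -(integralB measurableT (ifn n) intf).
apply: (le_abse_integral mu measurableT).
exact: (measurable_int _ (integrableB measurableT (ifn n) intf)).
Qed.

(** * Lebesgue integrable functions have determining sequences *)

Lemma cvg_L1_hazy (mu : {measure set T -> \bar R})
    (f_ : nat -> T -> R) (f : T -> R) :
  (forall n, measurable_fun [set: T] (f_ n)) -> measurable_fun [set: T] f ->
  (\int[mu]_x `|(f_ n x - f x)%:E|)%E @[n --> \oo] --> 0%E -> hazy_cvg mu f_ f.
Proof.
move=> mf_ mf f_f e e0.
have mfB n : measurable_fun [set: T] (fun x => (f_ n x - f x)%:E).
  by apply/measurable_EFinP/measurable_funB.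
pose I n := (e^-1%:E * \int[mu]_x `|(f_ n x - f x)%:E|)%E.
have I0 : I n @[n --> \oo] --> 0%E.
  by rewrite -(mule0 e^-1%:E); apply: cvgeZl.
apply: (squeeze_cvge _ (cvg_cst _) I0); apply: nearW => n.
rewrite outer_charge_ge0/=.
(* Markov's inequality bounds the set given by the large inequality; it is measurable and contains
   the strict one, so it competes in the infimum defining the outer charge. *)
have mA : measurable (setT `&` [set x | (e%:E <= `|(f_ n x - f x)%:E|)%E]).
  by apply: emeasurable_fun_c_infty => //; exact: measurableT_comp.
have := le_integral_abse mu measurableT (mfB n) e0.
rewrite /I lee_pdivlMl//; apply: le_trans.
rewrite lee_pmul2l//; apply: ereal_inf_lbound.
by exists (setT `&` [set x | (e%:E <= `|(f_ n x - f x)%:E|)%E]) => //; split => // x /= /ltW.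
Qed.

Lemma integrable_charge_integrable (mu : {finite_measure set T -> \bar R}) (f : T -> R) :
  mu.-integrable [set: T] (EFin \o f) -> charge_integrable mu f.
Proof.
move=> intf.
have mf : measurable_fun [set: T] f by apply/measurable_EFinP; exact: measurable_int intf.
have [f_ [_ _ f_f]] := approximation_sfun_integrable measurableT intf.
pose I n := (\int[mu]_x `|(f_ n x - f x)%:E|)%E.
have I0 : I n @[n --> \oo] --> 0%E.
  apply: cvg_trans f_f; apply: near_eq_cvg; apply: nearW => n.
  by apply: eq_integral => x _; rewrite -EFinB !abse_EFin distrC.
exists f_; split; first exact: cvg_L1_hazy I0.
(* By the triangle inequality through [f], [I n + I m] dominates the integral of [|f_ n - f_ m|]. *)
have II0 : (I nm.1 + I nm.2)%E @[nm --> (\oo, \oo)] --> (0 + 0)%E.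
  apply: cvgeD => //; first exact: (cvg_comp _ _ cvg_fst I0).
  exact: (cvg_comp _ _ cvg_snd I0).
rewrite adde0 in II0.
apply: (squeeze_cvge _ (cvg_cst _) II0); apply: nearW => -[n m] /=.
rewrite sintegral_norm_sfunB integral_ge0//= -ge0_integralD//; first last.
- by apply: measurable_abse_EFinB.
- by apply: measurable_abse_EFinB.
apply: ge0_le_integral => //.
- by apply: measurable_abse_EFinB.
- by apply: emeasurable_funD; apply: measurable_abse_EFinB.
- by move=> x _; rewrite -EFinD lee_fin (distrC (f_ m x)) ler_distD.
Qed.

End charge_integral.

Theorem corollary22 (d : measure_display) (T : measurableType d) (R : realType)
    (mu : {finite_measure set T -> \bar R})
    (mu_complete : measure_is_complete mu) (f : T -> R) :
  (charge_integrable mu f <-> mu.-integrable [set: T] (EFin \o f)) /\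
  (charge_integrable mu f -> is_charge_integral mu f (\int[mu]_x f x)).
Proof.
have fint : charge_integrable mu f -> mu.-integrable [set: T] (EFin \o f).
  by move=> [f_ /(determining_cvg_L1 mu_complete)[mf]]; exact: cvg_L1_integrable.
split; first by split => //; exact: integrable_charge_integrable.
move=> cf; split => // f_ /(determining_cvg_L1 mu_complete)[mf f_f].
(* The real-valued integral is the [fine] part of the extended one; integrability rules out the
   infinite values, which [fine] would send to 0. *)
rewrite fineK; last exact: integrable_fin_num (fint cf).
exact: cvg_L1_sintegral (fint cf) f_f.
Qed.
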